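(* Let $P$ be a nonempty pattern and write $\varphi(P)=\bigcup_{i=1}^r(v_i+T_{k_i})$ for its decomposition into triangles. Then $e(P)=0$ if and only if $P\in\gamma\left(\bigcup_{i=1}^r (v_i+H_{k_i})\right)$, where $H_k=\{(a,k-1):0\le a\le k-1\}$ is the horizontal line (top edge) generating $T_k$.
   Context: A pattern is a finite subset $P\subset\mathbb{Z}^2$. Let $T=\{(0,1),(1,1),(1,0)\}$ and $T_n=\{(a,b)\in\{0,\ldots,n-1\}^2 : a+b\geq n-1\}$. A solitaire move applies to $P$ at $v$ when $|P\cap(v+T)|=2$ and replaces $P$ by $(P\setminus(v+T))\cup S$ for an arbitrary two-element $S\subset v+T$; $\gamma(P)$ is the set of patterns reachable by finitely many moves. The filling $\varphi(P)$ is obtained by repeatedly adding a point $w$ whenever there is $v$ with $|P\cap(v+T)|=2$ (current set) and $w\in v+T$, until stable. With $N(x)=\{x\pm(1,0),x\pm(0,1),x\pm(1,-1)\}$ and $N(A)=\bigcup_{x\in A}N(x)$, the filling decomposes uniquely (up to order) as $\varphi(P)=\bigcup_{i=1}^r(v_i+T_{k_i})$ with $N(v_i+T_{k_i})\cap(v_j+T_{k_j})=\varnothing$ for $i\ne j$; the excess is $e(P)=|P|-\sum_i k_i$. *)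

(* Defs.v *)
From HB Require Import structures.
From mathcomp Require Import all_boot all_order all_algebra.
From mathcomp Require Import finmap zify.
From Stdlib Require Import Classical Relation_Operators.

Set Implicit Arguments.
Unset Strict Implicit.
Unset Printing Implicit Defensive.

Import Order.TTheory GRing.Theory Num.Theory.

Local Open Scope fset_scope.
Local Open Scope ring_scope.

Definition point : Type := (int * int)%type.
Definition pattern : Type := {fset point}.

Definition translate (v : point) (A : pattern) : pattern :=
  [fset v + x | x in A].

(* The three-point shape T. *)
Definition corner : pattern := [fset (0, 1); (1, 1); (1, 0)].

(* The triangle T_n; it is empty for n = 0. *)
Definition triangle (n : nat) : pattern :=
  [fset p in [fset (a%:Z, b%:Z) | a in iota 0 n, b in iota 0 n]
     | n%:Z - 1 <= p.1 + p.2].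

(* The top edge H_k of T_k. *)
Definition top_edge (k : nat) : pattern :=
  [fset (a%:Z, k%:Z - 1) | a in iota 0 k].

Definition move (P Q : pattern) : Prop :=
  exists (v : point) (S : pattern),
    [/\ #|` P `&` translate v corner| = 2%N,
        S `<=` translate v corner,
        #|` S| = 2%N
      & Q = (P `\` translate v corner) `|` S].

(* gamma P Q means that Q belongs to the orbit gamma(P). *)
Definition gamma : pattern -> pattern -> Prop := clos_refl_trans pattern move.

Definition fill_step (P Q : pattern) : Prop :=
  exists v w : point,
    [/\ #|` P `&` translate v corner| = 2%N,
        w \in translate v corner
      & Q = w |` P].

Definition stable (P : pattern) : Prop := forall Q, fill_step P Q -> Q = P.

(* is_filling P F means F = phi(P): F is stable and is obtained from P by
   successively adding points.  Lemmas filling_exists and filling_unique below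
   show that exactly one such F exists. *)
Definition is_filling (P F : pattern) : Prop :=
  clos_refl_trans pattern fill_step P F /\ stable F.

Definition neighbors (x : point) : pattern :=
  [fset x + (1, 0); x - (1, 0); x + (0, 1); x - (0, 1);
        x + (1, -1); x - (1, -1)].

Definition neighborhood (A : pattern) : pattern :=
  \bigcup_(x <- A) neighbors x.

(* The family of triangles v_i + T_{k_i} is the decomposition of F.  Since x is
   not an element of N(x), the condition on neighborhoods alone would allow the
   same one-point triangle to be listed several times; the third clause excludes
   this.  For all other pairs of triangles it follows from the fourth.
   Lemmas decomposition_exists and decomposition_unique below show that every
   filling has a decomposition, unique up to order. *)
Definition is_decomposition (F : pattern) (r : nat)
    (v : 'I_r -> point) (k : 'I_r -> nat) : Prop :=
  [/\ forall i, (0 < k i)%N,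
      F = \bigcup_(i in 'I_r) translate (v i) (triangle (k i)),
      forall i j, i != j ->
        translate (v i) (triangle (k i)) `&`
        translate (v j) (triangle (k j)) = fset0
    & forall i j, i != j ->
        neighborhood (translate (v i) (triangle (k i))) `&`
        translate (v j) (triangle (k j)) = fset0].

(* The excess |P| - sum_i k_i, for (k_i) the sizes of the triangles in the
   decomposition of the filling of P. *)
Definition excess (P : pattern) (r : nat) (k : 'I_r -> nat) : int :=
  #|` P|%:Z - \sum_(i < r) (k i)%:Z.

Lemma card_fset_lt (A B : pattern) x :
  {subset A <= B} -> x \in B -> x \notin A -> (#|` A| < #|` B|)%N.
Proof.
move=> AB xB xA; apply: fproper_ltn_card; rewrite fproperE; apply/andP; split.
  exact/fsubsetP.
by apply: contra xA => /fsubsetP; apply.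
Qed.

Lemma in_translate v A p : (p \in translate v A) = (p - v \in A).
Proof.
apply/imfsetP/idP => [[x /= xA ->]|h]; first by rewrite addrC addKr.
by exists (p - v) => //; rewrite addrC subrK.
Qed.

Lemma in_triangle n p : (p \in triangle n) =
  [&& p.1 < n%:Z, p.2 < n%:Z & n%:Z - 1 <= p.1 + p.2].
Proof.
apply/idP/idP; rewrite !inE /=.
  by move=> /andP[/imfset2P[a /= + [b /= + ->]]]; rewrite !mem_iota /=; lia.
case: p => x y /= /and3P[h1 h2 h3]; rewrite h3 andbT; apply/imfset2P.
exists `|x|%N; rewrite /= ?mem_iota; first lia.
by exists `|y|%N; rewrite /= ?mem_iota; [lia | congr pair; lia].
Qed.

Lemma in_translate_triangle v n p : (p \in translate v (triangle n)) =
  [&& p.1 - v.1 < n%:Z, p.2 - v.2 < n%:Z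
    & n%:Z - 1 <= (p.1 - v.1) + (p.2 - v.2)].
Proof. by rewrite in_translate in_triangle. Qed.

Lemma in_corner (v p : point) : (p \in translate v corner) =
  (p \in [:: (v.1, v.2 + 1); (v.1 + 1, v.2 + 1); (v.1 + 1, v.2)]).
Proof.
case: v p => [a b] [x y]; rewrite in_translate !inE /= -!pair_eqE /=.
by rewrite /GRing.add /GRing.opp /=; lia.
Qed.

Lemma card_corner (P : pattern) (v : point) :
  #|` P `&` translate v corner| =
  (((v.1, v.2 + 1)%R \in P) + ((v.1 + 1, v.2 + 1)%R \in P)
    + ((v.1 + 1, v.2)%R \in P))%N.
Proof.
pose s := [:: (v.1, v.2 + 1); (v.1 + 1, v.2 + 1); (v.1 + 1, v.2)].
have -> : P `&` translate v corner = [fset x in filter (mem P) s].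
  by apply/fsetP => x; rewrite in_fsetI in_corner !inE mem_filter !inE.
rewrite card_fseq undup_id; first by rewrite size_filter /= addn0 addnA.
apply: filter_uniq; rewrite /s /= !inE -!pair_eqE /=; lia.
Qed.

Lemma fill_mono (P G F : pattern) :
  clos_refl_trans pattern fill_step P G -> stable F -> P `<=` F -> G `<=` F.
Proof.
move=> PG sF; elim: PG => // [{}P {}G|? ? ? _ IH1 _ IH2 /IH1/IH2//].
move=> [v [w [c wv ->]]] /fsubsetP PF; apply/fsubsetP => x.
rewrite !inE => /orP[/eqP->{x}|/PF//].
case: (boolP (w \in F)) => // wF.
have h := fun c => sF (w |` F) (ex_intro _ v (ex_intro _ w (And3 c wv erefl))).
suff /h e : #|` F `&` translate v corner| = 2%N by move: wF; rewrite -e !inE eqxx.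
move: c wv wF; rewrite !card_corner in_corner !inE.
have H p : (p \in P) ==> (p \in F) by apply/implyP/PF.
move: (H (v.1, v.2 + 1)) (H (v.1 + 1, v.2 + 1)) (H (v.1 + 1, v.2)).
by move=> + + + + /or3P[] /eqP->; do 6![case: (_ \in _) => //].
Qed.

Lemma filling_unique (P F G : pattern) :
  is_filling P F -> is_filling P G -> F = G.
Proof.
have sub Q R : clos_refl_trans pattern fill_step Q R -> Q `<=` R.
  elim=> [{}Q {}R [v [w [_ _ ->]]]|//|? ? ? _ + _]; first exact: fsubsetUr.
  exact: fsubset_trans.
move=> [PF sF] [PG sG]; apply/eqP; rewrite eqEfsubset.
by rewrite (fill_mono PF sG (sub _ _ PG)) (fill_mono PG sF (sub _ _ PF)).
Qed.

Lemma stable_triangle v n : stable (translate v (triangle n)).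
Proof.
move=> Q [u [w [c wu ->]]]; apply/fsetP => x; rewrite !inE.
case: eqP => // ->{x} /=; symmetry; move: c wu.
rewrite card_corner in_corner !inE !in_translate_triangle.
by case: u w v => [a b] [x y] [s t]; rewrite -!pair_eqE /=; lia.
Qed.

Lemma pattern_bounded (P : pattern) :
  exists v n, P `<=` translate v (triangle n).
Proof.
pose f (p : point) := (`|p.1| + `|p.2|)%N.
pose m := (\sum_(p <- P) f p)%N.
exists (- (3 * m)%:Z, - (3 * m)%:Z), (4 * m + 1)%N.
apply/fsubsetP => p pP; have : (f p <= m)%N.
  by rewrite /m (big_rem p pP) /= leq_addr.
case: p {pP} => x y; rewrite in_translate_triangle /f /=; lia.
Qed.

Lemma filling_exists (P : pattern) : exists F, is_filling P F.
Proof.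
have [v [n]] := pattern_bounded P; set B := translate v _.
have [m] := ubnP #|` B `\` P|; elim: m => // m IH in P * => hm PB.
have [sP|nsP] := classic (stable P).
  by exists P; split => //; apply: rt_refl.
have [Q nQ] := not_all_ex_not _ _ nsP.
have [PQ /eqP QP] := imply_to_and _ _ nQ.
have QB : Q `<=` B.
  by apply: fill_mono PB; [exact: rt_step PQ|exact: stable_triangle].
have [|//|F [QF sF]] := IH Q.
  case: PQ QP QB => [_ [w [_ _ ->]]] QP; rewrite fsubUset fsub1set => /andP[wB _].
  have wP : w \notin P by apply: contra QP => wP; rewrite mem_fset1U.
  apply: leq_trans (card_fset_lt (x := w) _ _ _) hm; rewrite ?inE ?eqxx ?wP //.
  by move=> x; rewrite !inE negb_or -andbA => /and3P[_ -> ->].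
by exists F; split=> //; apply: rt_trans QF; apply: rt_step.
Qed.

Lemma stable_card (F : pattern) :
  stable F -> forall v, #|` F `&` translate v corner| <> 2%N.
Proof.
move=> sF v c2.
have [w wv wF] : exists2 w, w \in translate v corner & w \notin F.
  move: c2; rewrite card_corner.
  case: (boolP (_ \in _)) => [_|h _]; last first.
    by eexists; last exact: h; rewrite in_corner !inE eqxx.
  case: (boolP (_ \in _)) => [_|h _]; last first.
    by eexists; last exact: h; rewrite in_corner !inE eqxx orbT.
  case: (boolP (_ \in _)) => [//|h _].
  by eexists; last exact: h; rewrite in_corner !inE eqxx !orbT.
have e : w |` F = F by apply: sF; exists v, w.
by move: wF; rewrite -e !inE eqxx.
Qed.

Lemma card_stable (F : pattern) :
  (forall v, #|` F `&` translate v corner| <> 2%N) -> stable F.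
Proof. by move=> h Q [v [w [/h]]]. Qed.

Lemma line_const (G : int -> bool) (lo hi : int) :
  (forall y, lo <= y -> y < hi -> G (y + 1) = G y) ->
  forall y z, lo <= y <= hi -> lo <= z <= hi -> G y = G z.
Proof.
move=> step; suff h (j : nat) : lo + j%:Z <= hi -> G (lo + j%:Z) = G lo.
  move=> y z hy hz.
  have ey : lo + `|y - lo|%N%:Z = y by lia.
  have ez : lo + `|z - lo|%N%:Z = z by lia.
  by rewrite -ey -ez !h //; lia.
elim: j => [|j IH] hj; first by rewrite addr0.
have -> : lo + j.+1%:Z = lo + j%:Z + 1 by lia.
by rewrite step ?IH //; lia.
Qed.

Lemma in_neighbors (x y : point) : (x \in neighbors y) =
  [|| (x.1 == y.1 + 1) && (x.2 == y.2), (x.1 == y.1 - 1) && (x.2 == y.2),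
      (x.1 == y.1) && (x.2 == y.2 + 1), (x.1 == y.1) && (x.2 == y.2 - 1),
      (x.1 == y.1 + 1) && (x.2 == y.2 - 1)
    | (x.1 == y.1 - 1) && (x.2 == y.2 + 1)].
Proof.
case: x y => [a b] [c d]; rewrite !inE -!pair_eqE /=.
by rewrite /GRing.add /GRing.opp /=; lia.
Qed.

Lemma in_neighborhood (A : pattern) (x : point) :
  reflect (exists2 y, y \in A & x \in neighbors y) (x \in neighborhood A).
Proof.
apply: (iffP (bigfcupP _ _ _ _)) => [[y /andP[yA _] xy]|[y yA xy]].
  by exists y.
by exists y => //; rewrite yA.
Qed.

Lemma triangle_grow (F : pattern) v n (x : point) : stable F ->
  translate v (triangle n) `<=` F -> x \in F ->
  x \notin translate v (triangle n) ->
  x \in neighborhood (translate v (triangle n)) ->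
  exists v', [/\ translate v' (triangle n.+1) `<=` F,
    translate v (triangle n) `<=` translate v' (triangle n.+1)
    & x \in translate v' (triangle n.+1)].
Proof.
move=> /stable_card sF /fsubsetP AF xF xA /in_neighborhood[y yA xy].
have {}sF a b : (((a, b + 1)%R \in F) + ((a + 1, b + 1)%R \in F)
    + ((a + 1, b)%R \in F))%N <> 2%N.
  by have := sF (a, b); rewrite card_corner.
have {}AF a b : a - v.1 < n%:Z -> b - v.2 < n%:Z ->
    n%:Z - 1 <= (a - v.1) + (b - v.2) -> (a, b) \in F.
  by move=> h1 h2 h3; apply: AF; rewrite in_translate_triangle /= h1 h2 h3.
move: xA yA xy; rewrite !in_translate_triangle in_neighbors.
case: v x y xF AF => [v1 v2] [a b] [c d] /= xF AF xA yA xy.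
have [h|[h|h]] : a = v1 + n%:Z \/ b = v2 + n%:Z \/
    a + b = v1 + v2 + n%:Z - 2 by lia.
- exists (v1, v2 - 1); split; last 2 first.
  + by apply/fsubsetP => -[s t]; rewrite !in_translate_triangle /=; lia.
  + by rewrite !in_translate_triangle /=; lia.
  apply/fsubsetP => -[s t]; rewrite !in_translate_triangle /= => hst.
  have [?|?] := ltP s (v1 + n%:Z); first by apply: AF; lia.
  have -> : s = a by lia.
  apply: (etrans _ xF); apply: (@line_const (fun y => (a, y) \in F)
    (v2 - 1) (v2 + n%:Z - 1)); [|lia|lia] => z hz1 hz2 /=.
  have := sF (a - 1) z; rewrite subrK (AF (a - 1) (z + 1)); try lia.
  by case: (_ \in _); case: (_ \in _).
- exists (v1 - 1, v2); split; last 2 first.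
  + by apply/fsubsetP => -[s t]; rewrite !in_translate_triangle /=; lia.
  + by rewrite !in_translate_triangle /=; lia.
  apply/fsubsetP => -[s t]; rewrite !in_translate_triangle /= => hst.
  have [?|?] := ltP t (v2 + n%:Z); first by apply: AF; lia.
  have -> : t = b by lia.
  apply: (etrans _ xF); apply: (@line_const (fun y => (y, b) \in F)
    (v1 - 1) (v1 + n%:Z - 1)); [|lia|lia] => z hz1 hz2 /=.
  have := sF z (b - 1); rewrite subrK (AF (z + 1) (b - 1)); try lia.
  by case: (_ \in _); case: (_ \in _).
- exists (v1 - 1, v2 - 1); split; last 2 first.
  + by apply/fsubsetP => -[s t]; rewrite !in_translate_triangle /=; lia.
  + by rewrite !in_translate_triangle /=; lia.
  apply/fsubsetP => -[s t]; rewrite !in_translate_triangle /= => hst.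
  have [?|?] := leP (v1 + v2 + n%:Z - 1) (s + t); first by apply: AF; lia.
  have -> : t = a + b - s by lia.
  have {}xF : (a, a + b - a) \in F by rewrite addrC addKr.
  apply: (etrans _ xF); apply: (@line_const (fun y => (y, a + b - y) \in F)
    (v1 - 1) (v1 + n%:Z - 1)); [|lia|lia] => z hz1 hz2 /=.
  have := sF z (a + b - (z + 1)).
  have -> : a + b - (z + 1) + 1 = a + b - z by lia.
  rewrite (AF (z + 1) (a + b - z)); try lia.
  by case: (_ \in _); case: (_ \in _).
Qed.

Lemma max_triangle (F : pattern) x : stable F -> x \in F ->
  exists v n, [/\ (0 < n)%N, x \in translate v (triangle n),
    translate v (triangle n) `<=` F
    & forall y, y \in F -> y \in neighborhood (translate v (triangle n)) ->
      y \in translate v (triangle n)].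
Proof.
move=> sF xF.
suff h m v n : (#|` F `\` translate v (triangle n)| < m)%N -> (0 < n)%N ->
    x \in translate v (triangle n) -> translate v (triangle n) `<=` F ->
    exists v n, [/\ (0 < n)%N, x \in translate v (triangle n),
      translate v (triangle n) `<=` F
      & forall y, y \in F -> y \in neighborhood (translate v (triangle n)) ->
        y \in translate v (triangle n)].
  apply: (h _ x 1%N (leqnn _)) => //.
    by rewrite in_translate_triangle !subrr.
  apply/fsubsetP => y; rewrite in_translate_triangle => hy.
  suff -> : y = x by [].
  by case: x y hy {xF h} => [a b] [c d] /= hy; congr pair; lia.
elim: m v n => // m IH v n; set A := translate _ _ => hm n0 xA AF.
case: (classic (forall y, y \in F -> y \in neighborhood A -> y \in A)) => [maxA|].
  by exists v, n.
move=> nmax; have [y ny] := not_all_ex_not _ _ nmax.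
have [yF ny'] := imply_to_and _ _ ny.
have [yN /negP yA] := imply_to_and _ _ ny'.
have [v' [BF AB yB]] := triangle_grow sF AF yF yA yN.
apply: (IH v' n.+1) => //; last exact: (fsubsetP AB).
apply: leq_trans (card_fset_lt (x := y) _ _ _) hm; rewrite ?inE ?yB ?yA //.
move=> z; rewrite !inE => /andP[zB ->]; rewrite andbT.
by apply: contra zB; apply: (fsubsetP AB).
Qed.

Lemma neighbors_sym (x y : point) : (x \in neighbors y) = (y \in neighbors x).
Proof. by rewrite !in_neighbors; lia. Qed.

Lemma decomposition_exists (F : pattern) : stable F ->
  exists r (v : 'I_r -> point) (k : 'I_r -> nat), is_decomposition F v k.
Proof.
have [m] := ubnP #|` F|; elim: m => // m IH in F * => hm sF.
have [->|/fset0Pn[x xF]] := eqVneq F fset0.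
  exists 0%N, (fun=> 0), (fun=> 0%N); split; try by case.
  by rewrite big_pred0 // => -[].
have [v0 [n0 [n0_gt0 xA AF maxA]]] := max_triangle sF xF.
move: xA AF maxA; set A := translate _ _ => xA AF maxA.
have [||r [v [k [k0 eF dF nF]]]] := IH (F `\` A).
- apply: leq_trans (card_fset_lt (x := x) _ _ _) hm; rewrite ?inE ?xA //.
  by move=> z; rewrite !inE => /andP[].
- apply: card_stable => u c2; have := stable_card sF (v := u); move: c2.
  rewrite !card_corner.
  have E p : (p \in F `\` A) = (p \notin A) && (p \in F) by rewrite !inE.
  have nA p q : q \in neighbors p ->
      ((p \in A) ==> ((q \in F) ==> (q \in A))) &&
      ((q \in A) ==> ((p \in F) ==> (p \in A))).
    move=> qp; apply/andP; split; apply/implyP => h1; apply/implyP => h2;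
      apply: maxA => //; apply/in_neighborhood; first by exists p.
    by exists q => //; rewrite neighbors_sym.
  have sA p : (p \in A) ==> (p \in F) by apply/implyP/(fsubsetP AF).
  set p1 := (u.1, u.2 + 1); set p2 := (u.1 + 1, u.2 + 1); set p3 := (u.1 + 1, u.2).
  have := nA p1 p2; rewrite in_neighbors /= !eqxx /= => /(_ isT).
  have := nA p2 p3; rewrite in_neighbors /= ?addrK ?eqxx /= ?orbT => /(_ isT).
  have := nA p1 p3; rewrite in_neighbors /= ?addrK ?eqxx /= ?orbT => /(_ isT).
  move: (sA p1) (sA p2) (sA p3); rewrite !E {E nA sA}.
  move: (p1 \in A) (p2 \in A) (p3 \in A) (p1 \in F) (p2 \in F) (p3 \in F).
  by do 6![case => //].
have sub i y : y \in translate (v i) (triangle (k i)) -> y \in F `\` A.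
  by move=> yi; rewrite eF; apply/bigfcupP; exists i; rewrite // mem_index_enum.
have memA i y : y \in translate (v i) (triangle (k i)) -> y \in A -> False.
  by move=> /sub; rewrite inE => /andP[/negPf->].
exists r.+1, (fun i => if unlift ord0 i is Some j then v j else v0),
  (fun i => if unlift ord0 i is Some j then k j else n0); split.
- by move=> i; case: unliftP.
- rewrite (eq_bigl xpredT) // big_ord_recl unlift_none -/A.
  rewrite (eq_bigr (fun i => translate (v i) (triangle (k i)))); last first.
    by move=> i _; rewrite liftK.
  by rewrite -[\big[_/_]_(i < r) _]/(\bigcup_(i in 'I_r) _) -eF fsetUDl fsetDv fsetD0
    (fsetUidPr _ _ AF).
- move=> i j; case: unliftP => [i'|] ->; case: unliftP => [j'|] -> //.
  + by rewrite (inj_eq lift_inj) => /dF.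
  + move=> _; apply/fsetP => y; rewrite !inE; apply/negP => /andP[h1].
    exact: memA h1.
  + move=> _; apply/fsetP => y; rewrite !inE; apply/negP => /andP[h1 h2].
    exact: memA h2 h1.
- move=> i j; case: unliftP => [i'|] ->; case: unliftP => [j'|] -> //.
  + by rewrite (inj_eq lift_inj) => /nF.
  + move=> _; apply/fsetP => y; rewrite in_fsetI in_fset0; apply/negP.
    move=> /andP[/in_neighborhood[z zi yz] yA]; apply: (memA _ _ zi (maxA _ _ _)).
      by move/sub: zi; rewrite inE => /andP[].
    by apply/in_neighborhood; exists y => //; rewrite neighbors_sym.
  + move=> _; apply/fsetP => y; rewrite in_fsetI in_fset0; apply/negP.
    move=> /andP[yN yj]; apply: (memA _ _ yj (maxA _ _ yN)).
    by move/sub: yj; rewrite inE => /andP[].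
Qed.

Lemma triangle_connected (A : pattern) v n x :
  (forall p q, p \in translate v (triangle n) ->
     q \in translate v (triangle n) -> q \in neighbors p ->
     p \in A -> q \in A) ->
  x \in translate v (triangle n) -> x \in A ->
  translate v (triangle n) `<=` A.
Proof.
move=> step xT xA; have {}step p q : p \in translate v (triangle n) ->
     q \in translate v (triangle n) -> q \in neighbors p ->
     (q \in A) = (p \in A).
  move=> hp hq pq; apply/idP/idP; last exact: step.
  by apply: step => //; rewrite neighbors_sym.
suff h y : y \in translate v (triangle n) ->
    (y \in A) = ((v.1 + n%:Z - 1, v.2 + n%:Z - 1) \in A).
  by apply/fsubsetP => y yT; rewrite h // -(h x).
case: y => a b; rewrite in_translate_triangle /= => hab.
transitivity ((v.1 + n%:Z - 1, b) \in A).
  apply: (@line_const (fun z => (z, b) \in A) a (v.1 + n%:Z - 1));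
    [|lia|lia] => z h1 h2 /=.
  by apply: step; rewrite ?in_translate_triangle ?in_neighbors /=; lia.
apply: (@line_const (fun z => (_, z) \in A) b (v.2 + n%:Z - 1));
  [|lia|lia] => z h1 h2 /=.
by apply: step; rewrite ?in_translate_triangle ?in_neighbors /=; lia.
Qed.

Lemma triangle_inj v v' n n' : (0 < n)%N ->
  translate v (triangle n) = translate v' (triangle n') -> (v, n) = (v', n').
Proof.
move=> n0 /fsetP h.
have n0' : (0 < n')%N.
  have := h (v.1 + n%:Z - 1, v.2 + n%:Z - 1); rewrite !in_translate_triangle /=.
  lia.
have := h (v.1 + n%:Z - 1, v.2 + n%:Z - 1).
have := h (v.1, v.2 + n%:Z - 1).
have := h (v'.1 + n'%:Z - 1, v'.2 + n'%:Z - 1).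
have := h (v'.1, v'.2 + n'%:Z - 1).
rewrite !in_translate_triangle /=; case: v v' {h} => [a b] [c d] /= *.
by congr (_, _, _); lia.
Qed.

Lemma decomposition_refine (F : pattern)
    r (v : 'I_r -> point) (k : 'I_r -> nat)
    r' (v' : 'I_r' -> point) (k' : 'I_r' -> nat) :
  is_decomposition F v k -> is_decomposition F v' k' ->
  forall i, exists j, translate (v i) (triangle (k i)) `<=`
                      translate (v' j) (triangle (k' j)).
Proof.
move=> [k0 eF _ _] [k0' eF' dF' nF'] i.
have sub y : y \in translate (v i) (triangle (k i)) ->
    exists j, y \in translate (v' j) (triangle (k' j)).
  move=> yi; have : y \in F.
    by rewrite eF; apply/bigfcupP; exists i; rewrite // mem_index_enum.
  by rewrite eF' => /bigfcupP[j _ ?]; exists j.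
pose x := ((v i).1 + (k i)%:Z - 1, (v i).2 + (k i)%:Z - 1).
have xi : x \in translate (v i) (triangle (k i)).
  by have := k0 i; rewrite in_translate_triangle /=; lia.
have [j xj] := sub x xi; exists j; apply: triangle_connected xi xj.
move=> p q _ /sub[j' qj'] pq pj.
have [->//|/nF'/fsetP/(_ q)] := eqVneq j j'.
rewrite in_fsetI in_fset0 qj' andbT => /negP[]; apply/in_neighborhood.
by exists p.
Qed.

Lemma decomposition_unique (F : pattern)
    r (v : 'I_r -> point) (k : 'I_r -> nat)
    r' (v' : 'I_r' -> point) (k' : 'I_r' -> nat) :
  is_decomposition F v k -> is_decomposition F v' k' ->
  perm_eq [seq (v i, k i) | i <- enum 'I_r]
          [seq (v' i, k' i) | i <- enum 'I_r'].
Proof.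
have inj s (u : 'I_s -> point) (l : 'I_s -> nat) i j :
    is_decomposition F u l -> translate (u i) (triangle (l i)) `<=`
      translate (u j) (triangle (l j)) -> i = j.
  move=> [l0 _ dF _] /fsubsetP ij; apply/eqP/negPn/negP => /dF/fsetP.
  pose x := ((u i).1 + (l i)%:Z - 1, (u i).2 + (l i)%:Z - 1).
  have xi : x \in translate (u i) (triangle (l i)).
    by have := l0 i; rewrite in_translate_triangle /=; lia.
  by move=> /(_ x); rewrite !inE xi ij.
have unq s (u : 'I_s -> point) (l : 'I_s -> nat) :
    is_decomposition F u l -> uniq [seq (u i, l i) | i <- enum 'I_s].
  move=> D; rewrite map_inj_uniq ?enum_uniq // => i j [e1 e2].
  by apply: inj D _; rewrite e1 e2.
have half s (u : 'I_s -> point) (l : 'I_s -> nat)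
    s' (u' : 'I_s' -> point) (l' : 'I_s' -> nat) :
    is_decomposition F u l -> is_decomposition F u' l' ->
    {subset [seq (u i, l i) | i <- enum 'I_s]
         <= [seq (u' i, l' i) | i <- enum 'I_s']}.
  move=> D D' _ /mapP[i _ ->]; have [j ij] := decomposition_refine D D' i.
  have [i' ji'] := decomposition_refine D' D j.
  have e := inj _ _ _ _ _ D (fsubset_trans ij ji'); rewrite -{}e in ji'.
  have -> : (u i, l i) = (u' j, l' j).
    apply: triangle_inj; first by case: D.
    by apply/eqP; rewrite eqEfsubset ij ji'.
  by apply: map_f; rewrite mem_enum.
move=> D D'; apply: uniq_perm; [exact: unq|exact: unq|].
by move=> x; apply/idP/idP; apply: half.
Qed.

(* Main.v *)
(** Start from the family of one-point triangles given by P and repeatedly replace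
    two touching triangles, of sizes a and b, by the least triangle containing both;
    its size is at most a + b.  The process ends with the decomposition of the
    filling, so every pattern with filling F has at least sum_i k_i points, and if
    the excess is 0 then every merge has size exactly a + b.  In that case the edges
    of the two triangles can be carried by moves to an edge of the merged triangle.
    The remaining points never obstruct these moves: they could do so only by
    completing a corner, but a generating pattern of minimal cardinality contains no
    full corner.  The converse holds because moves preserve cardinality. *)

Require Import Defs.
From mathcomp Require Import all_boot all_order all_algebra finmap.
From mathcomp Require Import zify.
From Stdlib Require Import Relation_Operators.

Set Implicit Arguments.
Unset Strict Implicit.
Unset Printing Implicit Defensive.

Import Order.TTheory GRing.Theory Num.Theory.

Local Open Scope fset_scope.
Local Open Scope ring_scope.

(** * Moves, their reversibility and their symmetries *)

(** This form of a move, without the set [S], is symmetric in [P] and [Q]; together with [moveE] it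
    makes moves reversible. *)
Lemma moveI (v : point) (P Q : pattern) :
  (forall p, p \notin translate v corner -> (p \in P) = (p \in Q)) ->
  #|` P `&` translate v corner| = 2%N ->
  #|` Q `&` translate v corner| = 2%N -> move P Q.
Proof.
move=> PQ cP cQ; exists v, (Q `&` translate v corner); split=> //.
  exact: fsubsetIr.
apply/fsetP => p; rewrite in_fsetU in_fsetD in_fsetI.
by case: (boolP (p \in translate v corner)) => [|/PQ->]; rewrite ?andbT ?andbF ?orbF.
Qed.

Lemma moveE (P Q : pattern) : move P Q -> exists v : point,
  [/\ forall p, p \notin translate v corner -> (p \in P) = (p \in Q),
      #|` P `&` translate v corner| = 2%N
    & #|` Q `&` translate v corner| = 2%N].
Proof.
move=> [v [S [cP /fsubsetP SC cS ->]]]; exists v; split=> // [p pC|].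
  rewrite in_fsetU in_fsetD pC /=; case: (boolP (p \in S)) => [/SC|].
    by rewrite (negPf pC).
  by rewrite orbF.
rewrite -cS; congr #|` _|; apply/fsetP => p; rewrite in_fsetI in_fsetU in_fsetD.
case: (boolP (p \in S)) => [/SC->|]; first by rewrite orbT.
by rewrite orbF andbAC andNb.
Qed.

Lemma move_sym (P Q : pattern) : move P Q -> move Q P.
Proof. by case/moveE => v [h cP cQ]; apply: (@moveI v) => // p /h. Qed.

Lemma gamma_sym (P Q : pattern) : gamma P Q -> gamma Q P.
Proof.
elim=> [A B /move_sym|A|A B C _ BA _ CB]; [exact: rt_step|exact: rt_refl|].
exact: rt_trans CB BA.
Qed.

Lemma gamma_imfset (f : point -> point) : involutive f ->
  (forall v, exists v', forall p,
     (f p \in translate v' corner) = (p \in translate v corner)) ->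
  forall P Q : pattern, gamma P Q -> gamma (f @` P) (f @` Q).
Proof.
move=> fK fC P Q; have fI := inv_inj fK.
have memf (A : pattern) p : (p \in f @` A) = (f p \in A).
  by rewrite -{1}(fK p) mem_imfset.
have card_f v v' (A : pattern) :
    (forall p, (f p \in translate v' corner) = (p \in translate v corner)) ->
    #|` (f @` A) `&` translate v' corner| = #|` A `&` translate v corner|.
  move=> vv'; transitivity #|` f @` (A `&` translate v corner)|; last first.
    by rewrite card_imfset.
  by congr #|` _|; apply/fsetP => p; rewrite in_fsetI !memf in_fsetI -vv' fK.
elim=> [A B /moveE[v [h cA cB]]|A|A B C _ + _]; [|exact: rt_refl|exact: rt_trans].
have [v' vv'] := fC v; apply: rt_step; apply: (@moveI v').
- by move=> p; rewrite !memf -{1}(fK p) vv' => /h.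
- by rewrite (card_f v).
- by rewrite (card_f v).
Qed.

(* In the coordinates (x, y, - x - y) the corners are invariant, up to
   translation, under permutation of the three coordinates; flip and shear are
   two of these permutations. *)
Definition flip (p : point) : point := (p.2, p.1).

Definition shear (p : point) : point := (p.1, - p.1 - p.2).

Lemma flipK : involutive flip. Proof. by case. Qed.

Lemma shearK : involutive shear.
Proof. by case=> a b; rewrite /shear /=; congr pair; lia. Qed.

Lemma gamma_flip (P Q : pattern) : gamma P Q -> gamma (flip @` P) (flip @` Q).
Proof.
apply: gamma_imfset; first exact: flipK.
case=> a b; exists (b, a) => -[x y]; rewrite !in_corner !inE -!pair_eqE /=; lia.
Qed.

Lemma gamma_shear (P Q : pattern) : gamma P Q -> gamma (shear @` P) (shear @` Q).
Proof.
apply: gamma_imfset; first exact: shearK.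
case=> a b; exists (a, - a - b - 2) => -[x y].
rewrite !in_corner !inE -!pair_eqE /=; lia.
Qed.

Lemma in_flip (P : pattern) p : (p \in flip @` P) = ((p.2, p.1) \in P).
Proof. by rewrite -{1}(flipK p) mem_imfset //; apply: inv_inj flipK. Qed.

Lemma in_shear (P : pattern) p :
  (p \in shear @` P) = ((p.1, - p.1 - p.2) \in P).
Proof. by rewrite -{1}(shearK p) mem_imfset //; apply: inv_inj shearK. Qed.

(** * Segments in the three directions and sweeping by a row *)

Definition hseg (x y : int) (n : nat) : pattern :=
  [fset (x + a%:Z, y) | a in iota 0 n].

Definition vseg (x y : int) (n : nat) : pattern :=
  [fset (x, y + a%:Z) | a in iota 0 n].

Definition dseg (x y : int) (n : nat) : pattern :=
  [fset (x + a%:Z, y - a%:Z) | a in iota 0 n].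

Lemma in_hseg x y n p :
  (p \in hseg x y n) = [&& p.2 == y, x <= p.1 & p.1 < x + n%:Z].
Proof.
apply/imfsetP/idP => [[a /=]|]; first by rewrite mem_iota => ? -> /=; lia.
case: p => a b /= h; exists `|a - x|%N; rewrite /= ?mem_iota; first lia.
by congr pair; lia.
Qed.

Lemma in_vseg x y n p :
  (p \in vseg x y n) = [&& p.1 == x, y <= p.2 & p.2 < y + n%:Z].
Proof.
apply/imfsetP/idP => [[a /=]|]; first by rewrite mem_iota => ? -> /=; lia.
case: p => a b /= h; exists `|b - y|%N; rewrite /= ?mem_iota; first lia.
by congr pair; lia.
Qed.

Lemma in_dseg x y n p :
  (p \in dseg x y n) = [&& p.1 + p.2 == x + y, x <= p.1 & p.1 < x + n%:Z].
Proof.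
apply/imfsetP/idP => [[a /=]|]; first by rewrite mem_iota => ? -> /=; lia.
case: p => a b /= h; exists `|a - x|%N; rewrite /= ?mem_iota; first lia.
by congr pair; lia.
Qed.

(* A row of p + m + q points at height y, of which the m points following the
   first p have been absorbed, together with one further point, into the row at
   height y + 1; B is the rest of the pattern. *)
Definition row_state (B : pattern) (x y : int) (p m q : nat) : pattern :=
  hseg x y p `|` hseg (x + p%:Z + m%:Z) y q `|` hseg (x + p%:Z - 1) (y + 1) m.+1
    `|` B.

Lemma row_stateE B x y p m q u : (forall b, b \in B -> y + 1 < b.2) ->
  u.2 <= y + 1 ->
  (u \in row_state B x y p m q) =
  (u.2 == y) && ((x <= u.1 < x + p%:Z) ||
    (x + p%:Z + m%:Z <= u.1 < x + p%:Z + m%:Z + q%:Z)) ||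
  (u.2 == y + 1) && (x + p%:Z - 1 <= u.1 < x + p%:Z + m%:Z).
Proof.
move=> hB hu; rewrite !in_fsetU !in_hseg.
have -> : (u \in B) = false by apply/negP => /hB; lia.
rewrite orbF; case: u hu => a b /=; lia.
Qed.

Lemma row_state_move B x y p m q p' q' : (forall b, b \in B -> y + 1 < b.2) ->
  (p = p'.+1 /\ q = q' \/ p = p' /\ q = q'.+1) ->
  move (row_state B x y p m q) (row_state B x y p' m.+1 q').
Proof.
move=> hB h.
(* The corner whose lower point is the one to be absorbed. It contains the right end of the upper
   row if [p = p'], and the left end otherwise. *)
pose w : point := if p == p' then (x + p%:Z + m%:Z - 1, y) else (x + p%:Z - 2, y).
have hw : w = (x + p%:Z + m%:Z - 1, y) /\ p = p' \/
          w = (x + p%:Z - 2, y) /\ p = p'.+1.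
  by rewrite /w; case: eqP; [left|right]; split=> //; lia.
apply: (@moveI w).
- move=> u; rewrite in_corner => hu; rewrite !inE in hu.
  have [lu|gu] := leP u.2 (y + 1).
    rewrite !row_stateE //.
    case: u hu lu => a b; rewrite -!pair_eqE /=.
    by case: hw => -[-> ?] /=; lia.
  by rewrite !in_fsetU !in_hseg; lia.
- rewrite card_corner !row_stateE //=; case: hw => -[-> ?] /=; lia.
- rewrite card_corner !row_stateE //=; case: hw => -[-> ?] /=; lia.
Qed.

Lemma row_state_gamma B x y p m q : (forall b, b \in B -> y + 1 < b.2) ->
  gamma (row_state B x y p m q) (row_state B x y 0 (p + m + q) 0).
Proof.
move=> hB; elim: p m => [|p IH] m; last first.
  apply: (@rt_trans _ _ _ (row_state B x y p m.+1 q)).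
    by apply/rt_step/row_state_move => //; left.
  by rewrite addSnnS; apply: IH.
elim: q m => [|q IH] m; first by rewrite addn0; apply: rt_refl.
apply: (@rt_trans _ _ _ (row_state B x y 0 m.+1 q)).
  by apply/rt_step/row_state_move => //; right.
by rewrite -addSnnS; apply: IH.
Qed.

(** Each round lifts the row by one, lengthens it by the lowest point of the column and moves its
    left end one step left, so the rest of the column stands over point number [p + 1] of the new
    row. The value [p = 0] is a column whose foot is diagonally adjacent to the left end. *)
Lemma row_absorb_column x y n p a : (p <= n)%N ->
  gamma (hseg x y n `|` vseg (x + p%:Z - 1) (y + 1) a)
        (hseg (x - a%:Z) (y + a%:Z) (n + a)).
Proof.
elim: a x y n p => [|a IH] x y n p pn.
  rewrite subr0 addr0 addn0; have -> : vseg (x + p%:Z - 1) (y + 1) 0 = fset0.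
    by apply/fsetP => u; rewrite in_vseg in_fset0; lia.
  by rewrite fsetU0; apply: rt_refl.
pose B := vseg (x + p%:Z - 1) (y + 2) a.
have hB b : b \in B -> y + 1 < b.2 by rewrite in_vseg; lia.
have := @row_state_gamma B x y p 0 (n - p) hB; rewrite addn0 subnKC //.
have -> : row_state B x y p 0 (n - p) =
    hseg x y n `|` vseg (x + p%:Z - 1) (y + 1) a.+1.
  by apply/fsetP => u; rewrite !in_fsetU !in_hseg !in_vseg; lia.
have -> : row_state B x y 0 n 0 =
    hseg (x - 1) (y + 1) n.+1 `|` vseg (x - 1 + p.+1%:Z - 1) (y + 1 + 1) a.
  by apply/fsetP => u; rewrite !in_fsetU !in_hseg !in_vseg; lia.
move=> h; apply: rt_trans h _; have := IH (x - 1) (y + 1) n.+1 p.+1 pn.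
congr gamma; congr hseg; lia.
Qed.

(** The lowest point of the column is a one-point row, which absorbs the rest. *)
Lemma gamma_vseg_hseg x y n :
  gamma (vseg x y n) (hseg (x - n%:Z + 1) (y + n%:Z - 1) n).
Proof.
case: n => [|n].
  have -> : vseg x y 0 = hseg (x - 0%:Z + 1) (y + 0%:Z - 1) 0.
    by apply/fsetP => u; rewrite in_hseg in_vseg; lia.
  exact: rt_refl.
have := @row_absorb_column x y 1 1 n (leqnn _); congr gamma.
  by apply/fsetP => -[a b]; rewrite in_fsetU in_hseg !in_vseg /=; lia.
by apply/fsetP => -[a b]; rewrite !in_hseg /=; lia.
Qed.

(** [shear] keeps vertical lines and exchanges horizontal lines with antidiagonals. *)
Lemma gamma_vseg_dseg x y n :
  gamma (vseg x y n) (dseg (x - n%:Z + 1) (y + n%:Z - 1) n).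
Proof.
have := gamma_shear (@gamma_vseg_hseg x (- x - y - n%:Z + 1) n); congr gamma.
  by apply/fsetP => -[a b]; rewrite in_shear !in_vseg /=; lia.
by apply/fsetP => -[a b]; rewrite in_shear in_hseg in_dseg /=; lia.
Qed.

Lemma column_absorb_row x y n p a : (p <= n)%N ->
  gamma (vseg x y n `|` hseg (x + 1) (y + p%:Z - 1) a)
        (vseg (x + a%:Z) (y - a%:Z) (n + a)).
Proof.
move=> pn; have := gamma_flip (@row_absorb_column y x n p a pn); congr gamma.
  apply/fsetP => -[u w]; rewrite in_flip !in_fsetU !in_hseg !in_vseg /=; lia.
by apply/fsetP => -[u w]; rewrite in_flip !in_hseg !in_vseg /=; lia.
Qed.

Lemma diagonal_absorb_column x y n p a : (p <= n)%N ->
  gamma (dseg x y n `|` vseg (x + p%:Z - 1) (y - p%:Z - a%:Z + 1) a)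
        (dseg (x - a%:Z) y (n + a)).
Proof.
move=> pn; have := gamma_shear (@row_absorb_column x (- x - y) n p a pn).
congr gamma.
  apply/fsetP => -[u w].
  by rewrite in_shear !in_fsetU !in_hseg in_dseg !in_vseg /=; lia.
by apply/fsetP => -[u w]; rewrite in_shear !in_hseg !in_dseg /=; lia.
Qed.

(** * Triangles given by their three bounds, and merging *)

Definition tri (t : point * nat) : pattern := translate t.1 (triangle t.2).

Definition top (t : point * nat) : pattern := translate t.1 (top_edge t.2).

(* tri t is the set of (x, y) with x <= xmax t, y <= ymax t, smin t <= x + y; hence
   merge t u is the least triangle containing tri t and tri u, and touch t u says
   that their intersection has formal size (the sum of its bounds, plus one) at
   least 0, size 0 being adjacency. *)
Definition xmax (t : point * nat) : int := t.1.1 + t.2%:Z - 1.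
Definition ymax (t : point * nat) : int := t.1.2 + t.2%:Z - 1.
Definition smin (t : point * nat) : int := t.1.1 + t.1.2 + t.2%:Z - 1.

Definition merge (t u : point * nat) : point * nat :=
  let X : int := Num.max (xmax t) (xmax u) in
  let Y : int := Num.max (ymax t) (ymax u) in
  let Z : int := Num.min (smin t) (smin u) in
  ((Z - Y, Z - X), absz (X + Y - Z + 1)).

Definition touch (t u : point * nat) : bool :=
  Num.max (smin t) (smin u) <=
  Num.min (xmax t) (xmax u) + Num.min (ymax t) (ymax u) + 1.

Lemma topE t : top t = hseg t.1.1 (ymax t) t.2.
Proof.
case: t => -[x y] n; apply/fsetP => -[a b]; rewrite in_translate in_hseg /ymax /=.
apply/imfsetP/idP => /= [[c]|h]; first by rewrite mem_iota => ? [] *; lia.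
exists `|a - x|%N; rewrite ?mem_iota; first lia.
by congr pair; rewrite /=; lia.
Qed.

Lemma in_tri t p :
  (p \in tri t) = [&& p.1 <= xmax t, p.2 <= ymax t & smin t <= p.1 + p.2].
Proof.
case: t p => -[x y] n [a b]; rewrite in_translate_triangle /xmax /ymax /smin /=.
lia.
Qed.

(** Maximum plus minimum is the sum, so the size of the merge and the formal size of the
    intersection add up to [t.2 + u.2]; [touch] makes the latter nonnegative. *)
Lemma touch_merge_leq t u : touch t u -> ((merge t u).2 <= t.2 + u.2)%N.
Proof.
rewrite /touch /merge /=; case: (leP (xmax t) (xmax u)) => h1;
  case: (leP (ymax t) (ymax u)) => h2; case: (leP (smin t) (smin u)) => h3;
  move: h1 h2 h3; rewrite /xmax /ymax /smin /=; lia.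
Qed.

Lemma touchC t u : touch t u = touch u t.
Proof.
by rewrite /touch maxC (minC (xmax t)) (minC (ymax t)).
Qed.

Lemma mergeC t u : merge t u = merge u t.
Proof.
by rewrite /merge (maxC (xmax t)) (maxC (ymax t)) (minC (smin t)).
Qed.

Lemma touchxx t : (0 < t.2)%N -> touch t t.
Proof. by case: t => -[x y] n; rewrite /touch /xmax /ymax /smin /=; lia. Qed.

Lemma gamma_column_top t : gamma (vseg (xmax t) t.1.2 t.2) (top t).
Proof.
have := @gamma_vseg_hseg (xmax t) t.1.2 t.2; congr gamma.
by rewrite topE /xmax /ymax; congr hseg; lia.
Qed.

Lemma gamma_column_diagonal t :
  gamma (vseg (xmax t) t.1.2 t.2) (dseg t.1.1 (ymax t) t.2).
Proof.
have := @gamma_vseg_dseg (xmax t) t.1.2 t.2; congr gamma.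
by rewrite /xmax /ymax; congr dseg; lia.
Qed.

(* The size being exactly additive, one triangle t sticks out of the other one, u,
   across a single side of u: put u on that side, t on an edge transversal to it,
   and let the side of u sweep t layer by layer. *)
Lemma gamma_merge t u : (0 < t.2)%N -> (0 < u.2)%N ->
  (merge t u).2 = (t.2 + u.2)%N ->
  exists e1 e2, [/\ gamma (top t) e1, gamma (top u) e2
    & gamma (e1 `|` e2) (top (merge t u))].
Proof.
pose D t u := ymax u <= ymax t /\ xmax t <= xmax u /\ smin u <= smin t \/
  xmax u <= xmax t /\ ymax t <= ymax u /\ smin u <= smin t \/
  smin t <= smin u /\ xmax t <= xmax u /\ ymax t <= ymax u.
wlog : t u / D t u => [IH t0 u0 e|h t0 u0 e].
  (* Two of the three bounds compare the same way; containment of one triangle in the other is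
     excluded by additivity and positive sizes. *)
  have [h|h] : D t u \/ D u t.
    move: e; rewrite /D /merge.
    case: (leP (xmax t) (xmax u)) => h1; case: (leP (ymax t) (ymax u)) => h2;
      case: (leP (smin t) (smin u)) => h3; move: h1 h2 h3 t0 u0; clear;
      rewrite /xmax /ymax /smin /=; lia.
  - exact: IH.
  - have [|e1 [e2 [g1 g2 g]]] := IH _ _ h u0 t0; first by rewrite mergeC addnC.
    by exists e2, e1; split=> //; rewrite fsetUC mergeC.
have gc w := gamma_sym (gamma_column_top w).
have gd w := rt_trans _ _ _ _ _ (gc w) (gamma_column_diagonal w).
case: h => [[h1 [h2 h3]]|[[h1 [h2 h3]]|[h1 [h2 h3]]]].
(* Additivity means [ymax t = ymax u + t.2], so the right column of [t] starts one row above the top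
   of [u]. It stands over point number [xmax t + 1 - u.1.1] of that top, and [h3] makes this number
   nonnegative. The other two cases are analogous. *)
- rewrite /merge (max_r h2) (max_l h1) (min_r h3) /= in e *.
  exists (vseg (xmax t) t.1.2 t.2), (top u); split; [exact: gc|exact: rt_refl|].
  rewrite !topE; move: h1 h2 h3 e t0 u0; rewrite /xmax /ymax /smin /= => *.
  have := @row_absorb_column u.1.1 (ymax u) u.2 (absz (xmax t + 1 - u.1.1)%R) t.2.
  rewrite fsetUC /xmax /ymax => /(_ ltac:(lia)).
  congr gamma; last by congr hseg; lia.
  by congr fsetU; congr vseg; lia.
- rewrite /merge (max_l h1) (max_r h2) (min_r h3) /= in e *.
  exists (top t), (vseg (xmax u) u.1.2 u.2); split; [exact: rt_refl|exact: gc|].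
  apply: rt_trans (gamma_column_top _); rewrite !topE.
  move: h1 h2 h3 e t0 u0; rewrite /xmax /ymax /smin /= => *.
  have := @column_absorb_row (xmax u) u.1.2 u.2 (absz (ymax t + 1 - u.1.2)%R) t.2.
  rewrite fsetUC /xmax /ymax => /(_ ltac:(lia)).
  congr gamma; last by congr vseg; lia.
  by congr fsetU; congr hseg; lia.
rewrite /merge (max_r h2) (max_r h3) (min_l h1) /= in e *.
exists (vseg (xmax t) t.1.2 t.2), (dseg u.1.1 (ymax u) u.2).
split; [exact: gc|exact: gd|]; apply: rt_trans (gamma_sym (gd _)).
move: h1 h2 h3 e t0 u0; rewrite /xmax /ymax /smin /= => *.
have := @diagonal_absorb_column u.1.1 (ymax u) u.2 (absz (xmax t + 1 - u.1.1)%R) t.2.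
rewrite fsetUC /xmax /ymax => /(_ ltac:(lia)).
congr gamma; last by congr dseg; lia.
by congr fsetU; congr vseg; lia.
Qed.

(** * Fillings as least stable supersets *)

(** In this form, comparing fillings takes only inclusions in stable sets, with no filling sequence
    to follow. *)
Definition hull (P F : pattern) : Prop :=
  [/\ P `<=` F, stable F & forall G, stable G -> P `<=` G -> F `<=` G].

Lemma filling_hull (P F : pattern) : is_filling P F -> hull P F.
Proof.
move=> [PF sF]; split=> // [|G sG PG]; last exact: fill_mono PF sG PG.
elim: PF {sF} => [A B [v [w [_ _ ->]]]|A|A B C _ + _]; first exact: fsubsetUr.
  exact: fsubset_refl.
exact: fsubset_trans.
Qed.

Lemma stable_corner (P G : pattern) (v : point) : stable G -> P `<=` G ->
  #|` P `&` translate v corner| = 2%N -> translate v corner `<=` G.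
Proof.
move=> sG PG c; apply/fsubsetP => w wC.
have /fsubsetP : w |` P `<=` G.
  by apply: fill_mono sG PG; apply: rt_step; exists v, w.
by apply; rewrite !inE eqxx.
Qed.

(** Either side of a move forces the whole corner into a stable set, so both sides have the same
    stable supersets. *)
Lemma hull_move (P Q F : pattern) : move P Q -> hull P F -> hull Q F.
Proof.
have sub A B G : move A B -> stable G -> A `<=` G -> B `<=` G.
  move=> /moveE[v [h cA _]] sG AG; apply/fsubsetP => p pB.
  have [pC|/h e] := boolP (p \in translate v corner).
    exact: (fsubsetP (stable_corner sG AG cA)).
  by apply: (fsubsetP AG); rewrite e.
move=> PQ [PF sF minF]; split=> // [|G sG QG]; first exact: sub PQ sF PF.
exact: minF sG (sub _ _ _ (move_sym PQ) sG QG).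
Qed.

Lemma hull_gamma (P Q F : pattern) : gamma P Q -> hull P F -> hull Q F.
Proof. by elim=> [A B /hull_move|//|A B C _ IH1 _ IH2 /IH1/IH2]; apply. Qed.

Lemma card_move (P Q : pattern) : move P Q -> #|` P| = #|` Q|.
Proof.
move=> /moveE[v [h cP cQ]].
rewrite -(cardfsID (translate v corner) P) -(cardfsID (translate v corner) Q).
rewrite cP cQ; congr (2 + #|` _|)%N; apply/fsetP => p; rewrite !in_fsetD.
by case: (boolP (_ \in translate _ _)) => //= /h.
Qed.

Lemma card_gamma (P Q : pattern) : gamma P Q -> #|` P| = #|` Q|.
Proof. by elim=> [A B /card_move|//|A B C _ -> _ ->]. Qed.

(* A minimal generating pattern contains no full corner, since one of the three
   points would be redundant; so no third point can obstruct a move. *)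
Lemma gamma_context (F A A' B : pattern) N :
  (forall Q, hull Q F -> (N <= #|` Q|)%N) ->
  gamma A A' -> A `&` B = fset0 -> hull (A `|` B) F -> #|` A `|` B| = N ->
  gamma (A `|` B) (A' `|` B) /\ A' `&` B = fset0.
Proof.
move=> minN; elim=> [{}A {}A'|{}A|{}A C {}A' _ IH1 _ IH2]; last first.
- move=> dA hA cA; have [g1 dC] := IH1 dA hA cA.
  have [|||g2 dA'] := IH2 _ _ _; [done|exact: hull_gamma g1 hA| |].
    by rewrite -(card_gamma g1).
  by split=> //; apply: rt_trans g2.
- by move=> dA _ _; split=> //; apply: rt_refl.
move=> /moveE[v [h cA cA']] dA hAB cAB.
have nB p : p \in translate v corner -> p \notin B.
  move=> pC; apply/negP => pB.
  have pA : p \notin A.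
    by apply/negP => pA; have /fsetP/(_ p) := dA; rewrite in_fsetI pA pB in_fset0.
  have : hull ((A `|` B) `\ p) F.
    case: hAB => sub sF minF; split=> // [|G sG /fsubsetP QG].
      exact: fsubset_trans (fsubD1set _ _) sub.
    apply: minF => //; apply/fsubsetP => q qAB.
    have [->|qp] := eqVneq q p; last by apply: QG; rewrite !inE qp -in_fsetU.
    apply: (fsubsetP (stable_corner sG _ cA) p pC).
    apply/fsubsetP => z zA; apply: QG; rewrite in_fsetD1 in_fsetU zA /= andbT.
    by apply: contraNneq pA => <-.
  move/minN; rewrite -cAB [X in (X <= _)%N](cardfsD1 p) in_fsetU pB orbT.
  by rewrite add1n ltnn.
have memAB X p : p \in translate v corner -> (p \in X `|` B) = (p \in X).
  by move=> /nB/negPf pB; rewrite in_fsetU pB orbF.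
have capAB (X : pattern) :
    (X `|` B) `&` translate v corner = X `&` translate v corner.
  apply/fsetP => p; rewrite !in_fsetI.
  by case: (boolP (p \in translate v corner)) => [/memAB->|]; rewrite ?andbF.
split.
  apply: rt_step; apply: (@moveI v); rewrite ?capAB // => p pC.
  by rewrite !in_fsetU h.
apply/fsetP => p; rewrite in_fsetI in_fset0.
case: (boolP (p \in translate v corner)) => [/nB/negPf->|/h <-].
  by rewrite andbF.
by rewrite -in_fsetI dA.
Qed.

(** * Top edges and families of triangles *)

Lemma top_sub_tri t : top t `<=` tri t.
Proof.
apply/fsubsetP => -[a b]; rewrite topE in_hseg in_tri /xmax /ymax /smin /=; lia.
Qed.

(** Downwards row by row: [(a - 1, b + 1)] and [(a, b + 1)] force [(a, b)]. *)
Lemma stable_tri_top t (G : pattern) : stable G -> top t `<=` G -> tri t `<=` G.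
Proof.
move=> /stable_card sG /fsubsetP tG.
suff h (j : nat) a b : ymax t - j%:Z = b -> (a, b) \in tri t -> (a, b) \in G.
  apply/fsubsetP => -[a b] pt; apply: (h (absz (ymax t - b)%R)) (pt).
  by move: pt; rewrite in_tri /=; lia.
elim: j a b => [|j IH] a b e.
  rewrite in_tri => pt; apply: tG; rewrite topE in_hseg.
  by move: e pt; rewrite /xmax /ymax /smin /=; lia.
rewrite in_tri /= => pt; have := sG (a - 1, b); rewrite card_corner /= subrK.
have -> : (a - 1, b + 1) \in G by apply: IH; rewrite ?in_tri /=; lia.
have -> : (a, b + 1) \in G by apply: IH; rewrite ?in_tri /=; lia.
by case: (_ \in G).
Qed.

Definition tris (s : seq (point * nat)) : pattern := \bigcup_(t <- s) tri t.
Definition tops (s : seq (point * nat)) : pattern := \bigcup_(t <- s) top t.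

Lemma in_tris s p : reflect (exists2 t, t \in s & p \in tri t) (p \in tris s).
Proof.
apply: (iffP (bigfcupP _ _ _ _)) => [[t /andP[ts _] pt]|[t ts pt]].
  by exists t.
by exists t => //; rewrite ts.
Qed.

Lemma in_tops s p : reflect (exists2 t, t \in s & p \in top t) (p \in tops s).
Proof.
apply: (iffP (bigfcupP _ _ _ _)) => [[t /andP[ts _] pt]|[t ts pt]].
  by exists t.
by exists t => //; rewrite ts.
Qed.

Lemma hull_tops s (F : pattern) : hull (tris s) F -> hull (tops s) F.
Proof.
move=> [sub sF minF]; split=> // [|G sG /fsubsetP tG].
  apply: fsubset_trans sub; apply/fsubsetP => p /in_tops[t ts pt].
  by apply/in_tris; exists t => //; apply: (fsubsetP (top_sub_tri t)).
apply: minF => //; apply/fsubsetP => p /in_tris[t ts].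
apply/fsubsetP/stable_tri_top => //; apply/fsubsetP => q qt.
by apply: tG; apply/in_tops; exists t.
Qed.

Lemma card_top t : (#|` top t| <= t.2)%N.
Proof.
rewrite topE; apply: leq_trans (leq_imfset_card _ _ _) _ => /=.
by apply: leq_trans (size_undup _) _; rewrite size_iota.
Qed.

Lemma card_tops s : (#|` tops s| <= \sum_(t <- s) t.2)%N.
Proof.
rewrite /tops; elim: s => [|t s IH]; first by rewrite !big_nil cardfs0.
rewrite !big_cons; apply: leq_trans (leq_add (card_top t) IH).
by rewrite cardfsU leq_subr.
Qed.

(** * Touching triangles inside a decomposed filling *)

Lemma tri_bounds t u : (0 < t.2)%N -> tri t `<=` tri u ->
  [/\ xmax t <= xmax u, ymax t <= ymax u & smin u <= smin t].
Proof.
move=> t0 /fsubsetP h; have := h (xmax t, ymax t); have := h (t.1.1, ymax t).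
rewrite !in_tri /= /xmax /ymax /smin => h1 h2; split; move: h1 h2; lia.
Qed.

Lemma adjacent_touch t u p q : p \in tri t -> q \in tri u ->
  q = p \/ q \in neighbors p -> touch t u.
Proof.
move=> pt qu pq; have {pq} : [&& p.1 - 1 <= q.1, q.1 <= p.1 + 1,
    p.2 - 1 <= q.2, q.2 <= p.2 + 1, p.1 + p.2 - 1 <= q.1 + q.2 & q.1 + q.2 <= p.1 + p.2 + 1].
  case: pq => [->|]; first by lia.
  by case: p q {pt qu} => a b [c d]; rewrite in_neighbors /=; lia.
case: p q pt qu => a b [c d]; rewrite !in_tri /touch /=.
case: (leP (xmax t) (xmax u)) => ?; case: (leP (ymax t) (ymax u)) => ?;
  case: (leP (smin t) (smin u)) => ?; lia.
Qed.

Lemma touch_adjacent t u : (0 < t.2)%N -> (0 < u.2)%N -> touch t u ->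
  exists p q, [/\ p \in tri t, q \in tri u & q = p \/ q \in neighbors p].
Proof.
move=> t0 u0; rewrite /touch.
set X := Num.min (xmax t) _; set Y := Num.min (ymax t) _.
set Z := Num.max (smin t) _ => h.
have {t0} t0 : smin t <= xmax t + ymax t by move: t0; rewrite /xmax /ymax /smin; lia.
have {u0} u0 : smin u <= xmax u + ymax u by move: u0; rewrite /xmax /ymax /smin; lia.
have hX : X <= xmax t /\ X <= xmax u /\ (X = xmax t \/ X = xmax u) by lia.
have hY : Y <= ymax t /\ Y <= ymax u /\ (Y = ymax t \/ Y = ymax u) by lia.
have hZ : smin t <= Z /\ smin u <= Z /\ (Z = smin t \/ Z = smin u) by lia.
have [h'|h'] := leP Z (X + Y).
  by exists (X, Y), (X, Y); split; [| |by left]; rewrite in_tri /=; lia.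
(* The formal size is now 0, that is, [Z = X + Y + 1]. The three points listed are pairwise
   adjacent, and each of the two triangles contains one of them. *)
have pick w : smin w <= xmax w + ymax w -> X <= xmax w -> Y <= ymax w ->
    smin w <= Z -> exists2 p, p \in tri w &
    [|| (p == (X + 1, Y)), (p == (X, Y + 1)) | (p == (X, Y))].
  move=> hw h1 h2 h3.
  have [h4|h4] := ltP X (xmax w).
    by exists (X + 1, Y); rewrite ?eqxx // in_tri /=; lia.
  have [h5|h5] := ltP Y (ymax w).
    by exists (X, Y + 1); rewrite ?eqxx ?orbT // in_tri /=; lia.
  by exists (X, Y); rewrite ?eqxx ?orbT // in_tri /=; lia.
have [p pt hp] : exists2 p, p \in tri t &
    [|| p == (X + 1, Y), p == (X, Y + 1) | p == (X, Y)] by apply: pick; lia.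
have [q qu hq] : exists2 q, q \in tri u &
    [|| q == (X + 1, Y), q == (X, Y + 1) | q == (X, Y)] by apply: pick; lia.
exists p, q; split=> //; have [|pq] := eqVneq q p; [by left|right].
by move: pq; case/or3P: hp => /eqP->; case/or3P: hq => /eqP->;
  rewrite ?eqxx // in_neighbors /=; lia.
Qed.

(** A triangle is connected through neighbors, whereas distinct components have no neighboring
    points. *)
Lemma component_of_tri (F : pattern) r (v : 'I_r -> point) (k : 'I_r -> nat) t :
  is_decomposition F v k -> (0 < t.2)%N -> tri t `<=` F ->
  exists i, tri t `<=` tri (v i, k i).
Proof.
move=> [k0 eF dF nF] t0 /fsubsetP tF.
have comp y : y \in tri t -> exists j, y \in tri (v j, k j).
  by move=> /tF; rewrite eF => /bigfcupP[j _ ?]; exists j.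
have xt : (xmax t, ymax t) \in tri t.
  by rewrite in_tri /= /xmax /ymax /smin; lia.
have [j xj] := comp _ xt; exists j; apply: triangle_connected xt xj.
move=> p q _ /comp[j' qj'] pq pj.
have [->//|/nF/fsetP/(_ q)] := eqVneq j j'.
rewrite in_fsetI in_fset0 [q \in translate (v j') _]qj' andbT => /negP[].
by apply/in_neighborhood; exists p.
Qed.

(** The argument of [absz] in [merge] is at least [t.2], so the absolute value changes nothing. *)
Lemma merge_bounds t u : (0 < t.2)%N -> (0 < u.2)%N ->
  [/\ xmax (merge t u) = Num.max (xmax t) (xmax u),
      ymax (merge t u) = Num.max (ymax t) (ymax u),
      smin (merge t u) = Num.min (smin t) (smin u)
    & (0 < (merge t u).2)%N].
Proof.
move=> t0 u0.
have {t0} t0 : smin t <= xmax t + ymax t by move: t0; rewrite /xmax /ymax /smin; lia.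
have {u0} u0 : smin u <= xmax u + ymax u by move: u0; rewrite /xmax /ymax /smin; lia.
rewrite /merge; case: (leP (xmax t) (xmax u)) => h1;
  case: (leP (ymax t) (ymax u)) => h2; case: (leP (smin t) (smin u)) => h3;
  by rewrite [xmax (_, _)]/xmax [ymax (_, _)]/ymax [smin (_, _)]/smin /=; split; lia.
Qed.

(** Touching triangles lie in the same component of [F]; this component is a triangle, so it
    contains the merge. *)
Lemma merge_hull (F : pattern) r (v : 'I_r -> point) (k : 'I_r -> nat) t u s :
  is_decomposition F v k -> (0 < t.2)%N -> (0 < u.2)%N -> touch t u ->
  hull (tris [:: t, u & s]) F -> hull (tris (merge t u :: s)) F.
Proof.
move=> D t0 u0 tu [/fsubsetP sub sF minF].
have [eX eY eZ m0] := merge_bounds t0 u0.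
split=> // [|G sG /fsubsetP mG].
  have subF w : w \in [:: t, u & s] -> tri w `<=` F.
    by move=> ws; apply/fsubsetP => p pw; apply: sub; apply/in_tris; exists w.
  have tF : tri t `<=` F by apply: subF; rewrite !inE eqxx.
  have uF : tri u `<=` F by apply: subF; rewrite !inE eqxx orbT.
  have [i ti] := component_of_tri D t0 tF.
  have [j uj] := component_of_tri D u0 uF.
  have [p [q [pt qu pq]]] := touch_adjacent t0 u0 tu.
  have pi := fsubsetP ti _ pt; have qj := fsubsetP uj _ qu.
  case: D => k0 eF dF nF.
  have ij : i = j.
    apply/eqP/negPn/negP => ij; case: pq => [qp|qp].
      have /fsetP/(_ p) := dF _ _ ij; rewrite in_fsetI in_fset0.
      by rewrite [p \in translate (v i) _]pi -qp [q \in translate (v j) _]qj.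
    have /fsetP/(_ q) := nF _ _ ij; rewrite in_fsetI in_fset0.
    rewrite [q \in translate (v j) _]qj andbT => /negP[].
    by apply/in_neighborhood; exists p.
  subst j; have [b1 b2 b3] := tri_bounds t0 ti; have [c1 c2 c3] := tri_bounds u0 uj.
  apply/fsubsetP => z /in_tris[w]; rewrite in_cons => /predU1P[->|ws zw]; last first.
    by apply: (fsubsetP (subF w _)) => //; rewrite !inE ws !orbT.
  rewrite in_tri eX eY eZ => hz; rewrite eF; apply/bigfcupP.
  exists i; rewrite ?mem_index_enum // -[translate _ _]/(tri (v i, k i)) in_tri.
  move: hz; rewrite !le_max ge_min; move: b1 b2 b3 c1 c2 c3; clear.
  by move=> b1 b2 b3 c1 c2 c3 /and3P[/orP[] ? /orP[] ? /orP[] ?]; lia.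
apply: minF => //; apply/fsubsetP => p /in_tris[w ws pw]; apply: mG; apply/in_tris.
move: ws; rewrite !inE => /or3P[/eqP e|/eqP e|ws]; last first.
- by exists w; rewrite // inE ws orbT.
- exists (merge t u); rewrite ?inE ?eqxx // in_tri eX eY eZ.
  by move: pw; rewrite e in_tri !le_max ge_min; lia.
- exists (merge t u); rewrite ?inE ?eqxx // in_tri eX eY eZ.
  by move: pw; rewrite e in_tri !le_max ge_min; lia.
Qed.

(** * Separated families are decompositions *)

Definition separated (s : seq (point * nat)) : bool :=
  pairwise (fun t u => ~~ touch t u) s.

Lemma separated_or_touching s : separated s \/
  exists t u s', perm_eq s [:: t, u & s'] /\ touch t u.
Proof.
elim: s => [|x s [IH|[t [u [s' [e tu]]]]]]; first by left.
  case: (boolP (has (touch x) s)) => [/hasP[u us xu]|nx].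
    right; exists x, u, (rem u s); split=> //.
    by rewrite perm_cons; apply: perm_to_rem.
  by left; rewrite /separated /= -all_predC in nx *; rewrite nx.
right; exists t, u, (x :: s'); split=> //.
apply: (@perm_trans _ ([:: x] ++ [:: t; u] ++ s')); first by rewrite perm_cons.
by rewrite perm_catCA.
Qed.

Lemma separated_eq s t u : separated s -> t \in s -> u \in s -> touch t u -> t = u.
Proof.
elim: s => // x s IH /= /andP[/allP nx ss]; rewrite !inE.
case/predU1P=> [->|ts] /predU1P[->|us] tu //; last exact: IH.
- by have := nx _ us; rewrite tu.
- by have := nx _ ts; rewrite touchC tu.
Qed.

Lemma separated_uniq s : all (fun t => 0 < t.2)%N s -> separated s -> uniq s.
Proof.
elim: s => // x s IH /= /andP[x0 s0] /andP[/allP nx ss]; rewrite IH // andbT.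
by apply/negP => /nx; rewrite touchxx.
Qed.

(** Any two points of a corner are neighbors, so if both are covered they lie in one triangle of
    [s], and that triangle is itself stable. *)
Lemma stable_separated s : separated s -> stable (tris s).
Proof.
move=> ss; apply: card_stable => v.
have in_one p q : p \in tris s -> q \in tris s -> q \in neighbors p ->
    exists2 t, t \in s & (p \in tri t) && (q \in tri t).
  move=> /in_tris[t ts pt] /in_tris[u us qu] pq; exists t => //.
  rewrite pt (separated_eq ss ts us) //.
  by apply: adjacent_touch pt qu _; right.
have notin t p : t \in s -> p \notin tris s -> (p \in tri t) = false.
  by move=> ts /negP np; apply/negP => pt; apply: np; apply/in_tris; exists t.
have no2 t : #|` tri t `&` translate v corner| <> 2%N.
  by apply: stable_card; apply: stable_triangle.
rewrite card_corner.
case: (boolP (_ \in _)) => h1; case: (boolP (_ \in _)) => h2;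
  case: (boolP (_ \in _)) => h3 //= _.
- have [|t ts /andP[t1 t2]] := in_one _ _ h1 h2.
    by rewrite in_neighbors /=; lia.
  by apply: (no2 t); rewrite card_corner t1 t2 (notin t).
- have [|t ts /andP[t1 t2]] := in_one _ _ h1 h3.
    by rewrite in_neighbors /=; lia.
  by apply: (no2 t); rewrite card_corner t1 t2 (notin t).
- have [|t ts /andP[t1 t2]] := in_one _ _ h2 h3.
    by rewrite in_neighbors /=; lia.
  by apply: (no2 t); rewrite card_corner t1 t2 (notin t).
Qed.

(** By stability [F = tris s], so [s] is a decomposition of [F] and uniqueness applies. *)
Lemma separated_perm (F : pattern) r (v : 'I_r -> point) (k : 'I_r -> nat) s :
  is_decomposition F v k -> all (fun t => 0 < t.2)%N s -> separated s ->
  hull (tris s) F -> perm_eq [seq (v i, k i) | i <- enum 'I_r] s.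
Proof.
move=> D s0 ss [sub _ minF].
pose g i := tnth (in_tuple s) i.
have gs i : g i \in s := mem_tnth i (in_tuple s).
have g_inj : injective g by apply/tuple_uniqP; apply: separated_uniq.
have D' : is_decomposition F (fun i => (g i).1) (fun i => (g i).2).
  split.
  - by move=> i; apply: (allP s0).
  - have -> : F = tris s.
      by apply/eqP; rewrite eqEfsubset sub andbT minF //; apply: stable_separated.
    by rewrite /tris big_tnth; apply: eq_bigl.
  - move=> i j ij; apply/fsetP => p; rewrite in_fsetI in_fset0.
    apply/negP => /andP[pi pj]; case/eqP: ij; apply: g_inj.
    by apply: (separated_eq ss) => //; apply: (adjacent_touch pi pj); left.
  - move=> i j ij; apply/fsetP => p; rewrite in_fsetI in_fset0.
    apply/negP => /andP[/in_neighborhood[q qi pq] pj].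
    case/eqP: ij; apply: g_inj; apply: (separated_eq ss) => //.
    by apply: (adjacent_touch qi pj); right.
apply: perm_trans (decomposition_unique D D') _.
rewrite (eq_map (g := g)); first by rewrite map_tnth_enum.
by move=> i; case: (g i).
Qed.

Lemma perm_tris s s' : perm_eq s s' -> tris s = tris s'.
Proof. exact: perm_big. Qed.

Lemma perm_tops s s' : perm_eq s s' -> tops s = tops s'.
Proof. exact: perm_big. Qed.

(** * The least number of generating points *)

(** Induction on the length of [s]: a merge shortens the list, keeps the hull and does not raise the
    total. *)
Lemma decomposition_size_leq (F : pattern)
    r (v : 'I_r -> point) (k : 'I_r -> nat) s :
  is_decomposition F v k -> all (fun t => 0 < t.2)%N s -> hull (tris s) F ->
  (\sum_(i < r) k i <= \sum_(t <- s) t.2)%N.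
Proof.
move=> D; have [n] := ubnP (size s); elim: n => // n IH in s * => hn s0 hs.
case: (separated_or_touching s) => [ss|[t [u [s' [e tu]]]]].
  have := separated_perm D s0 ss hs => /(perm_big _) <- /=.
  by rewrite big_map big_enum.
rewrite (perm_all _ e) (perm_tris e) (perm_size e) (perm_big _ e) /= in s0 hs hn *.
have /and3P[t0 u0 s0'] := s0.
have [_ _ _ m0] := merge_bounds t0 u0.
apply: leq_trans (IH (merge t u :: s') _ _ _) _ => //=.
- by rewrite m0.
- exact: merge_hull D t0 u0 tu hs.
by rewrite !big_cons addnA leq_add2r touch_merge_leq.
Qed.

Definition points (P : pattern) : seq (point * nat) := [seq (p, 1%N) | p <- P].

Lemma tri1 p : tri (p, 1%N) = [fset p].
Proof.
by apply/fsetP => -[a b]; case: p => x y; rewrite in_tri inE -pair_eqE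
  /xmax /ymax /smin /=; lia.
Qed.

Lemma top1 p : top (p, 1%N) = [fset p].
Proof.
by apply/fsetP => -[a b]; case: p => x y; rewrite topE in_hseg inE -pair_eqE
  /ymax /=; lia.
Qed.

Lemma tris_points P : tris (points P) = P.
Proof.
apply/fsetP => p; apply/in_tris/idP => [[_ /mapP[q qP ->]]|pP].
  by rewrite tri1 inE => /eqP->.
by exists (p, 1%N); rewrite ?tri1 ?inE // map_f.
Qed.

Lemma tops_points P : tops (points P) = P.
Proof.
apply/fsetP => p; apply/in_tops/idP => [[_ /mapP[q qP ->]]|pP].
  by rewrite top1 inE => /eqP->.
by exists (p, 1%N); rewrite ?top1 ?inE // map_f.
Qed.

Lemma size_points P : (\sum_(t <- points P) t.2)%N = #|` P|.
Proof. by rewrite big_map sum1_size. Qed.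

Lemma points_gt0 P : all (fun t => 0 < t.2)%N (points P).
Proof. by apply/allP => _ /mapP[p _ ->]. Qed.

Lemma hull_card_geq (F : pattern) r (v : 'I_r -> point) (k : 'I_r -> nat) Q :
  is_decomposition F v k -> hull Q F -> (\sum_(i < r) k i <= #|` Q|)%N.
Proof.
move=> D hQ; rewrite -size_points; apply: decomposition_size_leq D _ _.
  exact: points_gt0.
by rewrite tris_points.
Qed.

(** * Carrying a minimal family to the top edges of the decomposition *)

Lemma fsetI_eq0_card (A B : pattern) m n : (#|` A| <= m)%N -> (#|` B| <= n)%N ->
  (m + n <= #|` A `|` B|)%N -> A `&` B = fset0.
Proof.
move=> hA hB h; apply: cardfs0_eq; have e := cardfsUI A B.
apply/eqP; rewrite -leqn0 -(leq_add2l #|` A `|` B|) e addn0.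
exact: leq_trans (leq_add hA hB) h.
Qed.

Lemma gamma_tops (F : pattern) r (v : 'I_r -> point) (k : 'I_r -> nat) s :
  is_decomposition F v k -> all (fun t => 0 < t.2)%N s -> hull (tris s) F ->
  (\sum_(t <- s) t.2 = \sum_(i < r) k i)%N ->
  gamma (tops s) (tops [seq (v i, k i) | i <- enum 'I_r]).
Proof.
move=> D; have [n] := ubnP (size s); elim: n => // n IH in s * => hn s0 hs es.
case: (separated_or_touching s) => [ss|[t [u [s' [e tu]]]]].
  by rewrite (perm_tops (separated_perm D s0 ss hs)); apply: rt_refl.
rewrite (perm_all _ e) (perm_tris e) (perm_size e) (perm_big _ e) (perm_tops e) /=
  in s0 hs hn es *.
have /and3P[t0 u0 s0'] := s0.
have [_ _ _ m0] := merge_bounds t0 u0.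
have mpos : all (fun t => 0 < t.2)%N (merge t u :: s') by rewrite /= m0.
have mhull := merge_hull D t0 u0 tu hs.
(* A smaller merge would bring the total below the bound of [decomposition_size_leq]. *)
have em : (merge t u).2 = (t.2 + u.2)%N.
  apply/eqP; rewrite eqn_leq touch_merge_leq //=.
  have := decomposition_size_leq D mpos mhull.
  by rewrite -es !big_cons addnA leq_add2r.
have {IH} g := IH (merge t u :: s') hn mpos mhull.
apply: rt_trans (g _); last by rewrite -es !big_cons em addnA.
have minN Q : hull Q F -> (\sum_(i < r) k i <= #|` Q|)%N := hull_card_geq D.
have := hull_tops hs; rewrite /tops !big_cons -!/(tops _) => ht.
(* The cardinality lies between the minimum for generators of [F] and the sum of the sizes, which
   agree; this forces the disjointness in [d1] and [d2]. *)
have ct : #|` top t `|` (top u `|` tops s')| = (\sum_(i < r) k i)%N.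
  apply/eqP; rewrite eqn_leq minN // andbT -es.
  by have := card_tops [:: t, u & s']; rewrite /tops !big_cons.
have [d1 d2] : top t `&` (top u `|` tops s') = fset0 /\ top u `&` tops s' = fset0.
  have cX : (u.2 + \sum_(w <- s') w.2 <= #|` top u `|` tops s'|)%N.
    rewrite -(leq_add2l t.2).
    apply: (@leq_trans #|` top t `|` (top u `|` tops s')|).
      by rewrite ct -es !big_cons.
    by rewrite cardfsU (leq_trans (leq_subr _ _)) // leq_add2r card_top.
  split; last exact: fsetI_eq0_card (card_top u) (card_tops s') cX.
  apply: (fsetI_eq0_card (card_top t)) (leqnn _) _.
  rewrite ct -es !big_cons leq_add2l.
  by have := card_tops (u :: s'); rewrite /tops !big_cons.
(* [gamma_context] is applied three times: to [top t], to [top u], and to their images [e1] and [e2]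
   together, with the rest of the pattern as context. *)
have [e1 [e2 [g1 g2 g3]]] := gamma_merge t0 u0 em.
have [h1 dd1] := gamma_context minN g1 d1 ht ct.
have ht1 := hull_gamma h1 ht.
have ct1 : #|` e1 `|` (top u `|` tops s')| = (\sum_(i < r) k i)%N.
  by rewrite -(card_gamma h1).
apply: rt_trans h1 _.
rewrite fsetUCA in ht1 ct1 *.
have d3 : top u `&` (e1 `|` tops s') = fset0.
  apply/fsetP => p; move/fsetP: d2 => /(_ p); move/fsetP: dd1 => /(_ p).
  by rewrite !inE; do 3![case: (_ \in _) => //=].
have [h2 dd2] := gamma_context minN g2 d3 ht1 ct1.
have ht2 := hull_gamma h2 ht1.
have ct2 : #|` e2 `|` (e1 `|` tops s')| = (\sum_(i < r) k i)%N.
  by rewrite -(card_gamma h2).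
apply: rt_trans h2 _.
rewrite fsetUCA fsetUA in ht2 ct2 *.
have d4 : (e1 `|` e2) `&` tops s' = fset0.
  apply/fsetP => p; move/fsetP: dd2 => /(_ p); move/fsetP: dd1 => /(_ p).
  by rewrite !inE; do 4![case: (_ \in _) => //=].
by have [h3 _] := gamma_context minN g3 d4 ht2 ct2.
Qed.

Theorem theorem1 (P F : pattern) (r : nat)
    (v : 'I_r -> point) (k : 'I_r -> nat)
    (hP : P <> fset0) (hF : is_filling P F) (hd : is_decomposition F v k) :
  excess P k = 0 <->
  gamma (\bigcup_(i in 'I_r) translate (v i) (top_edge (k i))) P.
Proof.
pose d := [seq (v i, k i) | i <- enum 'I_r].
have tops_d : \bigcup_(i in 'I_r) translate (v i) (top_edge (k i)) = tops d.
  by rewrite /tops big_map big_enum.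
have excess_eq0 : excess P k = 0 <-> #|` P| = (\sum_(i < r) k i)%N.
  rewrite /excess -(big_morph Posz PoszD erefl).
  by split=> [/eqP|->]; rewrite ?subrr // subr_eq0 => /eqP[->].
have hPF := filling_hull hF.
rewrite excess_eq0 tops_d; split=> [cP|g].
  (* [P] is the union of the tops of its one-point triangles. *)
  apply: gamma_sym; have := gamma_tops hd (points_gt0 P).
  by rewrite tris_points tops_points size_points; apply.
(* The lower bound holds for every generator of [F]; the upper one counts the top edges. *)
apply/eqP; rewrite eqn_leq (hull_card_geq hd hPF) andbT.
rewrite -(card_gamma g); apply: leq_trans (card_tops d) _.
by rewrite big_map big_enum.
Qed.
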